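(* Let $G=SL_n(\mathbb C)$ or $G=GL_n(\mathbb C)$, let $B$ be the Borel subgroup of upper triangular matrices, and let $w\in S_n$. If there exist $x\in\mathfrak g$ and a Hessenberg space $H\subseteq\mathfrak g$ such that $\mathcal B(x,H)=X_w$, then $w$ avoids the pattern $[4231]$.
   Context: $\mathfrak g$ is the Lie algebra of $G$ and $\mathfrak b$ that of $B$. The Weyl group is $S_n$; $w\in S_n$ is written in one-line notation $[w_1\cdots w_n]$, $w_i=w(i)$, and $\dot w$ is a scalar multiple in $G$ of the permutation matrix with $e_i\mapsto e_{w(i)}$. $X_w$ is the closure in $G/B$ of $B\dot wB/B$. A Hessenberg space is a subspace $H\subseteq\mathfrak g$ with $[\mathfrak b,H]\subseteq H$; $\mathcal B(x,H)=\{gB\in G/B:g^{-1}xg\in H\}$. For $v\in S_m$, $w\in S_n$, $w$ contains the pattern $v$ if there are indices $i_1<\dots<i_m$ such that for all $a,b\in[m]$, $w_{i_a}<w_{i_b}$ iff $v_a<v_b$; otherwise $w$ avoids $v$. *)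

(* Defs.v *)
From HB Require Import structures.
From mathcomp Require Import all_boot all_order all_algebra all_fingroup.
From mathcomp Require Import Rstruct complex.
From mathcomp Require mpoly.
Set Implicit Arguments. Unset Strict Implicit. Unset Printing Implicit Defensive.
Import GRing.Theory Num.Theory.
Local Open Scope ring_scope.

Definition C : Type := complex Rdefinitions.R.
HB.instance Definition _ := GRing.Field.on C.

Definition inG (sl : bool) n (g : 'M[C]_n) : Prop :=
  if sl then \det g = 1 else \det g != 0.

Definition in_lie (sl : bool) n (X : 'M[C]_n) : Prop :=
  if sl then \tr X = 0 else True.

Definition upper n (A : 'M[C]_n) : Prop := forall i j : 'I_n, (j < i)%N -> A i j = 0.

Definition inB (sl : bool) n (g : 'M[C]_n) : Prop := inG sl g /\ upper g.
Definition in_borel_lie (sl : bool) n (X : 'M[C]_n) : Prop := in_lie sl X /\ upper X.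

Definition lie_bracket n (X Y : 'M[C]_n) : 'M[C]_n := X *m Y - Y *m X.

Definition hessenberg_space (sl : bool) n (H : {vspace 'M[C]_n}) : Prop :=
  (forall Y, Y \in H -> in_lie sl Y) /\
  (forall X Y, in_borel_lie sl X -> Y \in H -> lie_bracket X Y \in H).

(* Permutation matrix of w : e_i |-> e_{w(i)} *)
Definition pmat n (w : 'S_n) : 'M[C]_n := \matrix_(i, j) (i == w j)%:R.

(* The Bruhat cell B w B (preimage in G); wdot ranges over the scalar
   multiples of the permutation matrix lying in G. *)
Definition bruhat_cell (sl : bool) n (w : 'S_n) (g : 'M[C]_n) : Prop :=
  exists b1 b2 (c : C), [/\ inB sl b1, inB sl b2, inG sl (c *: pmat w) &
     g = b1 *m (c *: pmat w) *m b2].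

Definition mx_eval n (p : mpoly.mpoly (n * n) C) (g : 'M[C]_n) : C :=
  mpoly.meval (fun k => mxvec g 0 k) p.

Definition zariski_closure_in_G (sl : bool) n (S : 'M[C]_n -> Prop) (g : 'M[C]_n) : Prop :=
  inG sl g /\
  forall p : mpoly.mpoly (n * n) C, (forall s, S s -> mx_eval p s = 0) -> mx_eval p g = 0.

(* Preimage in G of the Schubert variety X_w *)
Definition schubert (sl : bool) n (w : 'S_n) : 'M[C]_n -> Prop :=
  zariski_closure_in_G sl (bruhat_cell sl w).

(* Preimage in G of the Hessenberg variety B(x, H) *)
Definition hessenberg_variety (sl : bool) n (x : 'M[C]_n) (H : {vspace 'M[C]_n})
  (g : 'M[C]_n) : Prop := inG sl g /\ (invmx g *m x *m g) \in H.

(* Pattern containment; the pattern v is given in one-line notation (values 1..m) *)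
Definition contains_pattern (v : seq nat) n (w : 'S_n) : Prop :=
  exists f : 'I_(size v) -> 'I_n,
    (forall a b : 'I_(size v), (a < b)%N -> (f a < f b)%N) /\
    (forall a b : 'I_(size v), (w (f a) < w (f b))%N = (nth 0 v a < nth 0 v b)%N).

Definition avoids_pattern (v : seq nat) n (w : 'S_n) : Prop := ~ contains_pattern v w.

(* Main.v *)
Require Import Defs.
From mathcomp Require Import all_boot all_order all_algebra all_fingroup.
From mathcomp Require Import Rstruct complex.
From mathcomp Require Import mpoly ring.
Set Implicit Arguments. Unset Strict Implicit. Unset Printing Implicit Defensive.
Import GRing.Theory Num.Theory.
Local Open Scope ring_scope.

(* Suppose w has the pattern 4231 at positions p < q < r < s, and let v be w
   rearranged to the pattern 3412 there; v is not below w in Bruhat order, by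
   the rank of a south-west block. If B(x,H) = X_w, then u^-1 x u lies in H for
   every u <= w. As H is stable under the diagonal part of b, the off-diagonal
   entries and the diagonal part of u^-1 x u lie in H separately. Each
   off-diagonal entry of v^-1 x v occurs at the same place of u^-1 x u, or at a
   place from which [b, -] moves it to the right one, for some u <= w whose
   pattern is 1432, 3214, 3142 or 2413; the diagonal part of v^-1 x v is a signed
   sum of those for 1432, 1234 and 3214. Hence v^-1 x v lies in H and v lies in
   X_w, a contradiction. *)

(** * Complex scalars and polynomials restricted to lines *)

Lemma natC_neq0 k : k.+1%:R != 0 :> C.
Proof. by have := @pnatr_eq0 (complex Rdefinitions.R) k.+1 => /= /negbT. Qed.

Lemma natC_inj : injective (fun k => k.+1%:R : C).
Proof.
by move=> a b /eqP; rewrite (@eqr_nat (complex Rdefinitions.R)) eqSS => /eqP.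
Qed.

Lemma nth_rootC n (a : C) : (0 < n)%N -> exists c : C, c ^+ n = a.
Proof.
move=> n_gt0; exists (n.-root (a : complex Rdefinitions.R)).
exact: (@rootCK (complex Rdefinitions.R)).
Qed.

(** The points 1, 2, ..., [size q] are distinct and nonzero, and they are more roots than a nonzero
    polynomial of that size can have. *)
Lemma horner0_punctured (q : {poly C}) :
  (forall t, t != 0 -> q.[t] = 0) -> q.[0] = 0.
Proof.
move=> q0; suff -> : q = 0 by rewrite horner0.
apply/eqP; case: eqVneq => // nz_q.
have := @max_poly_roots _ q (map (fun k => k.+1%:R) (iota 0 (size q))) nz_q.
rewrite size_map size_iota ltnn => -> //.
  by apply/allP => t /mapP [k _ ->]; apply/eqP/q0/natC_neq0.
by rewrite map_inj_uniq ?iota_uniq //; exact: natC_inj.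
Qed.

Lemma meval_line n (p : {mpoly C[n]}) (a e : 'I_n -> C) :
  exists q : {poly C}, forall t, q.[t] = p.@[fun k => a k + t * e k].
Proof.
exists (\sum_(m <- msupp p)
   p@_m *: \prod_i ((a i)%:P + e i *: 'X) ^+ m i) => t.
rewrite mevalE horner_sum; apply: eq_bigr => m _.
rewrite hornerZ horner_prod; congr (_ * _); apply: eq_bigr => i _.
by rewrite horner_exp !hornerE mulrC.
Qed.

(** The one limit argument of the proof: vanishing of a polynomial on a punctured line extends to
    its missing point. *)
Lemma mx_eval_line0 n (p : {mpoly C[n * n]}) (A E : 'M[C]_n) :
  (forall t, t != 0 -> mx_eval p (A + t *: E) = 0) -> mx_eval p A = 0.
Proof.
have [q qE] := meval_line p (fun k => mxvec A 0 k) (fun k => mxvec E 0 k).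
have evE t : mx_eval p (A + t *: E) = q.[t].
  by rewrite qE; apply: meval_eq => k; rewrite linearD linearZ !mxE.
move=> p0; have -> : A = A + 0 *: E by rewrite scale0r addr0.
by rewrite evE; apply: horner0_punctured => t /p0; rewrite evE.
Qed.

(** * The group and its Borel subgroup *)

Section Group.
Variables (sl : bool) (n : nat).
Implicit Types (A B g : 'M[C]_n) (u v w : 'S_n).

Lemma inG_mul A B : inG sl A -> inG sl B -> inG sl (A *m B).
Proof.
rewrite /inG det_mulmx; case: sl => [-> ->|]; first by rewrite mulr1.
exact: mulf_neq0.
Qed.

Lemma inG_mulIl A B : inG sl B -> inG sl (A *m B) -> inG sl A.
Proof.
rewrite /inG det_mulmx; case: sl => [->|_]; first by rewrite mulr1.
by rewrite mulf_eq0 negb_or => /andP [].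
Qed.

Lemma inG_unit A : inG sl A -> A \in unitmx.
Proof.
by rewrite unitmxE unitfE /inG; case: sl => [->|//]; rewrite oner_neq0.
Qed.

Lemma upper_mul A B : upper A -> upper B -> upper (A *m B).
Proof.
move=> uA uB i j ji; rewrite mxE big1 // => k _.
have [ki|ik] := ltnP k i; first by rewrite uA ?mul0r.
by rewrite uB ?mulr0 //; exact: leq_trans ik.
Qed.

Lemma inB_mul A B : inB sl A -> inB sl B -> inB sl (A *m B).
Proof.
by move=> [? ?] [? ?]; split; [exact: inG_mul|exact: upper_mul].
Qed.

Lemma upper_transvection (t : C) (i j : 'I_n) :
  (i < j)%N -> upper (1%:M + t *: delta_mx i j).
Proof.
move=> ij k l lk; rewrite !mxE.
have /negPf -> : k != l by rewrite -val_eqE gtn_eqF.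
case: andP => [[/eqP ki /eqP lj]|_]; last by rewrite mulr0 addr0.
by rewrite ki lj ltnNge (ltnW ij) in lk.
Qed.

Lemma inG_transvection (t : C) (i j : 'I_n) :
  i != j -> inG sl (1%:M + t *: delta_mx i j).
Proof.
have lt_case (a b : 'I_n) : (a < b)%N -> \det (1%:M + t *: delta_mx a b : 'M[C]_n) = 1.
  move=> ab; rewrite -det_tr det_trig; last first.
    by apply/is_trig_mxP => k l kl; rewrite mxE upper_transvection.
  rewrite big1 // => k _; rewrite !mxE eqxx.
  have [->|] := eqVneq k a; last by rewrite mulr0 addr0.
  have /negPf -> : a != b by rewrite -val_eqE ltn_eqF.
  by rewrite mulr0 addr0.
move=> ij; suff det1 : \det (1%:M + t *: delta_mx i j : 'M[C]_n) = 1.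
  by rewrite /inG det1; case: sl; rewrite ?oner_neq0.
have [/lt_case //|ji] := ltnP i j.
rewrite -det_tr linearD linearZ /= trmx1 trmx_delta lt_case //.
by rewrite ltn_neqAle ji val_eqE eq_sym ij.
Qed.

(** * Permutation matrices and Bruhat order *)

Lemma pmat_mul_delta u (i j : 'I_n) :
  pmat u *m delta_mx i j = delta_mx (u i) j.
Proof.
apply/matrixP => k l; rewrite mxE (bigD1 i) //= big1 => [|m mi].
  by rewrite !mxE eqxx addr0 /= -natrM mulnb.
by rewrite !mxE (negPf mi) mulr0.
Qed.

Lemma delta_mul_pmat u (i j : 'I_n) :
  delta_mx i (u j) *m pmat u = delta_mx i j.
Proof.
apply/matrixP => k l; rewrite mxE (bigD1 (u j)) //= big1 => [|m mi].
  by rewrite !mxE eqxx addr0 andbT -natrM mulnb (inj_eq perm_inj) (eq_sym j).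
by rewrite !mxE (negPf mi) andbF mul0r.
Qed.

Lemma pmat_mxE u A i j : (pmat u *m A) (u i) j = A i j.
Proof.
rewrite mxE (bigD1 i) //= big1 => [|m mi].
  by rewrite mxE eqxx mul1r addr0.
by rewrite mxE (inj_eq perm_inj) (eq_sym i) (negPf mi) mul0r.
Qed.

Lemma mx_pmatE u A i j : (A *m pmat u) i j = A i (u j).
Proof.
rewrite mxE (bigD1 (u j)) //= big1 => [|m mi].
  by rewrite mxE eqxx mulr1 addr0.
by rewrite mxE (negPf mi) mulr0.
Qed.

Lemma pmatE u : pmat u = (perm_mx u)^T.
Proof. by apply/matrixP => i j; rewrite !mxE eq_sym. Qed.

(** An n-th root of the sign of [u] normalises the determinant to 1, which serves both groups at
    once. *)
Lemma pmat_scaled u : (0 < n)%N -> exists c : C, inG sl (c *: pmat u).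
Proof.
move=> n_gt0; have [c cn] := nth_rootC ((-1) ^+ u) n_gt0.
exists c; suff : \det (c *: pmat u) = 1.
  by rewrite /inG => ->; case: sl; rewrite ?oner_neq0.
by rewrite detZ pmatE det_tr det_perm cn -signr_addb addbb.
Qed.

(* The cell of v lies in the Zariski closure of the cell of w: Bruhat order. *)
Definition below v w := forall g, bruhat_cell sl v g ->
  forall p : {mpoly C[n * n]},
    (forall s, bruhat_cell sl w s -> mx_eval p s = 0) -> mx_eval p g = 0.

(* In rows u j < u i and columns i < j this is
   [[1,0],[t,1]] = [[1,1/t],[0,1]] diag(-1/t,t) [[0,1],[1,0]] [[1,1/t],[0,1]]. *)
Lemma transvection_in_cell u (i j : 'I_n) (t : C) :
  (i < j)%N -> (u j < u i)%N -> t != 0 ->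
  exists2 D : 'M[C]_n, upper D &
  (1%:M + t *: delta_mx (u i) (u j)) *m pmat (tperm i j * u) =
  (1%:M + t^-1 *: delta_mx (u j) (u i)) *m D *m pmat u
    *m (1%:M + t^-1 *: delta_mx i j).
Proof.
move=> ij ba tn0; set u' := (tperm i j * u)%g.
have u'i : u' i = u j by rewrite permM tpermL.
have u'j : u' j = u i by rewrite permM tpermR.
pose d k : C := if k == u j then - t^-1 else if k == u i then t else 1.
exists (\matrix_(k, l) (d k *+ (k == l))).
  move=> k l lk; rewrite mxE; have /negPf -> // : k != l.
  by rewrite -val_eqE gtn_eqF.
set D := (X in _ *m X *m _ *m _).
set a := u j in u'i *; set b := u i in u'j *.
have nab : (a == b) = false by rewrite -val_eqE ltn_eqF.
have nba : (b == a) = false by rewrite eq_sym.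
set s := t^-1; have ts : t * s = 1 by rewrite divff.
(* As [u] is [u'] followed by [tperm a b], the bracket is [D] times the matrix of that
   transposition. With [pmat u'] moved to the right, an identity in E_ab and E_ba remains. *)
have DP : D *m pmat u =
   (1%:M - s *: delta_mx a b + t *: delta_mx b a - delta_mx a a - delta_mx b b)
     *m pmat u'.
  apply/matrixP => k l; rewrite !mx_pmatE !mxE permM /d -/a -/b -/s.
  have uE : u l = tperm a b (u (tperm i j l)).
    case: (tpermP i j l) => [->|->|/eqP li /eqP lj].
    - by rewrite tpermL.
    - by rewrite tpermR.
    - by rewrite tpermD // ?(inj_eq perm_inj) eq_sym.
  rewrite uE; move: (u (tperm i j l)) => m; clear uE.
  case: (tpermP a b m) => [->|->|/eqP ma /eqP mb].
  - case: (eqVneq k a) => [->|ka]; rewrite ?eqxx ?nab ?nba /=; first by ring.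
    by case: (eqVneq k b) => [kb|kb]; rewrite ?kb ?eqxx ?nab ?nba /=; ring.
  - case: (eqVneq k a) => [->|ka]; rewrite ?eqxx ?nab ?nba /=; first by ring.
    by case: (eqVneq k b) => [kb|kb]; rewrite ?kb ?eqxx ?nab ?nba /=; ring.
  - have [am bm] : (a == m) = false /\ (b == m) = false.
      by rewrite !(eq_sym _ m) (negPf ma) (negPf mb).
    case: (eqVneq k a) => [->|ka];
      rewrite ?am ?(negPf ma) ?(negPf mb) ?eqxx ?nab ?nba /=; first by ring.
    by case: (eqVneq k b) => [kb|kb];
      rewrite ?kb ?bm ?(negPf ma) ?(negPf mb) ?andbF ?eqxx ?nab ?nba /=; ring.
have comm : pmat u' *m (1%:M + s *: delta_mx i j) =
            (1%:M + s *: delta_mx a b) *m pmat u'.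
  by rewrite mulmxDr mulmxDl mulmx1 mul1mx -scalemxAr -scalemxAl
     pmat_mul_delta u'i -u'j delta_mul_pmat.
rewrite -(mulmxA _ D) DP -!mulmxA comm !mulmxA; congr (_ *m _).
set X := delta_mx a b; set Y := delta_mx b a.
have XX : X *m X = 0 by rewrite mul_delta_mx_0 ?nba.
have XY : X *m Y = delta_mx a a by rewrite mul_delta_mx.
have YX : Y *m X = delta_mx b b by rewrite mul_delta_mx.
have aX : delta_mx a a *m X = X by rewrite mul_delta_mx.
(* The usual factorisation of a Weyl element of SL2; its outer factors cancel against the two
   transvections with parameter 1/t. *)
have -> : 1%:M - s *: X + t *: Y - delta_mx a a - delta_mx b b =
  (1%:M - s *: X) *m (1%:M + t *: Y) *m (1%:M - s *: X).
  have -> : (1%:M - s *: X) *m (1%:M + t *: Y) =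
            1%:M + t *: Y - s *: X - delta_mx a a.
    rewrite mulmxBl mul1mx -scalemxAl mulmxDr mulmx1 -scalemxAr XY.
    by rewrite scalerDr scalerA mulrC ts scale1r opprD addrA.
  rewrite mulmxBr mulmx1 -scalemxAr !(mulmxDl, mulNmx) mul1mx -!scalemxAl.
  rewrite XX YX aX.
  by apply/matrixP => k l; rewrite !mxE; ring: ts.
have c1 : (1%:M + s *: X) *m (1%:M - s *: X) = 1%:M.
  rewrite mulmxDl mul1mx -scalemxAl mulmxBr mulmx1 -scalemxAr XX scaler0 subr0.
  by rewrite subrK.
have c2 : (1%:M - s *: X) *m (1%:M + s *: X) = 1%:M.
  rewrite mulmxBl mul1mx -scalemxAl mulmxDr mulmx1 -scalemxAr XX scaler0 addr0.
  by rewrite addrK.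
by rewrite !mulmxA c1 mul1mx -mulmxA c2 mulmx1.
Qed.

Lemma below_refl w : below w w.
Proof. by move=> g gw p; apply. Qed.

(** Removing an inversion goes down: with 1 + t E inserted after [b1], a point of the smaller cell
    becomes the value at t = 0 of a line whose other points lie in the cell of [u]. *)
Lemma below_tperm u w (i j : 'I_n) :
  (i < j)%N -> (u j < u i)%N -> below u w -> below (tperm i j * u) w.
Proof.
move=> ij ba uw g [b1 [b2 [c' [B1 B2 Gc' ->]]]] p pw.
have n_gt0 : (0 < n)%N by exact: leq_ltn_trans (leq0n i) (ltn_ord i).
have [c Gc] := pmat_scaled u n_gt0.
have c0 : c != 0.
  have := inG_unit Gc; rewrite unitmxE unitfE detZ mulf_eq0 negb_or expf_eq0.
  by rewrite n_gt0 => /andP [].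
apply: (mx_eval_line0
  (E := b1 *m (delta_mx (u i) (u j) *m (c' *: pmat (tperm i j * u))) *m b2)).
move=> t t0; apply: (uw _ _ _ pw).
have [D uD DE] := transvection_in_cell ij ba t0.
have nab : u j != u i by rewrite -val_eqE ltn_eqF.
pose T1 := 1%:M + t^-1 *: delta_mx (u j) (u i) : 'M[C]_n.
pose T2 := 1%:M + t^-1 *: delta_mx i j : 'M[C]_n.
pose D' := (c' / c) *: D.
have T1B : inB sl T1.
  by split; [exact: inG_transvection|exact: upper_transvection].
have T2B : inB sl T2.
  split; last exact: upper_transvection.
  by apply: inG_transvection; rewrite -val_eqE ltn_eqF.
have E1 : (1%:M + t *: delta_mx (u i) (u j)) *m (c' *: pmat (tperm i j * u)) =
    T1 *m D' *m (c *: pmat u) *m T2.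
  rewrite -scalemxAr DE /D' -!(scalemxAr, scalemxAl) scalerA.
  by rewrite mulrC divfK.
(* [D] is only known to be upper triangular; that [D'] lies in G follows from [E1], all of whose
   other factors do. *)
have D'B : inB sl D'.
  split; last by move=> k l lk; rewrite mxE uD ?mulr0.
  apply: (inG_mulIl Gc); apply: (inG_mulIl T2B.1).
  have {E1} : inG sl (T1 *m D' *m (c *: pmat u) *m T2).
    by rewrite -E1; apply: inG_mul => //; apply: inG_transvection; rewrite eq_sym.
  case: T1B => G1 _; rewrite /inG -!mulmxA det_mulmx.
  move: G1; rewrite /inG; case: (sl) => [->|_]; first by rewrite mul1r.
  by rewrite mulf_eq0 negb_or => /andP [].
exists (b1 *m (T1 *m D')), (T2 *m b2), c; split => //.
- by apply: inB_mul => //; apply: inB_mul.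
- exact: inB_mul.
have -> : b1 *m (T1 *m D') *m (c *: pmat u) *m (T2 *m b2) =
          b1 *m (T1 *m D' *m (c *: pmat u) *m T2) *m b2 by rewrite !mulmxA.
rewrite -E1; move: (c' *: pmat _) => Z.
by rewrite mulmxDl mul1mx mulmxDr mulmxDl -scalemxAl -scalemxAr -scalemxAl.
Qed.

Lemma below_schubert v w (c : C) :
  below v w -> inG sl (c *: pmat v) -> schubert sl w (c *: pmat v).
Proof.
move=> vw Gc; split => // p pw; apply: (vw _ _ _ pw).
have B1 : inB sl (1%:M : 'M[C]_n).
  split; last by move=> i j ij; rewrite mxE -val_eqE gtn_eqF.
  by rewrite /inG det1; case: (sl); rewrite ?oner_neq0.
by exists 1%:M, 1%:M, c; split=> //; rewrite mul1mx mulmx1.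
Qed.

Lemma conj_pmat u (c : C) A : inG sl (c *: pmat u) ->
  invmx (c *: pmat u) *m A *m (c *: pmat u) = \matrix_(i, j) A (u i) (u j).
Proof.
move=> /inG_unit cu; rewrite -mulmxA; apply: (canLR (mulKmx cu)).
rewrite -scalemxAl -scalemxAr; congr (_ *: _).
apply/matrixP => i j; rewrite -(permKV u i) pmat_mxE mx_pmatE.
by rewrite !mxE.
Qed.

(** * Ranks of south-west blocks *)

Definition ind_mx (K : pred 'I_n) : 'M[C]_n := diag_mx (\row_i (K i)%:R).

Lemma ind_mxM K A i j : (ind_mx K *m A) i j = (K i)%:R * A i j.
Proof. by rewrite mul_diag_mx !mxE. Qed.

Lemma mx_indM K A i j : (A *m ind_mx K) i j = A i j * (K j)%:R.
Proof. by rewrite mul_mx_diag !mxE. Qed.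

Lemma rank_ind_mx K : (\rank (ind_mx K) <= #|K|)%N.
Proof.
rewrite /ind_mx diag_mx_sum_delta (bigID K) /= addrC big1 ?add0r; last first.
  by move=> i /negPf Ki; rewrite mxE Ki scale0r.
rewrite -sum1_card; elim/big_ind2: _ => [|x X y Y xX yY|i Ki].
- by rewrite mxrank0.
- exact: leq_trans (mxrank_add _ _) (leq_add xX yY).
- by rewrite mxE Ki scale1r mxrank_delta.
Qed.

(** Take the determinant of the same expression in a matrix of indeterminates; evaluation is a ring
    morphism. *)
Lemma mx_eval_det_affine (A B D : 'M[C]_n) :
  exists p : {mpoly C[n * n]}, forall g, mx_eval p g = \det (A *m g *m B + D).
Proof.
pose cst := map_mx (@mpolyC (n * n) C).
pose X : 'M[{mpoly C[n * n]}]_n := \matrix_(i, j) 'X_(mxvec_index i j).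
exists (\det (cst _ _ A *m X *m cst _ _ B + cst _ _ D)) => g.
rewrite /mx_eval -det_map_mx map_mxD !map_mxM.
have cstK M : map_mx (meval (fun k => mxvec g 0 k)) (cst n n M) = M.
  by apply/matrixP => i j; rewrite !mxE mevalC.
have -> : map_mx (meval (fun k => mxvec g 0 k)) X = g.
  by apply/matrixP => i j; rewrite !mxE mevalXU mxvecE.
by rewrite !cstK.
Qed.

(** Indexed by columns: those up to q whose 1 in [pmat w] lies below row m, so that the cardinality
    is the rank of the block. *)
Definition sw_block w (m q : nat) : pred 'I_n :=
  [pred i : 'I_n | (i <= q)%N && (m < w i)%N].

Lemma pmat_sw_block w m q :
  ind_mx [pred i : 'I_n | (m < i)%N] *m pmat w *m ind_mx [pred i : 'I_n | (i <= q)%N] =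
  pmat w *m ind_mx (sw_block w m q).
Proof.
apply/matrixP => i j; rewrite !mx_indM ind_mxM !mxE /=.
case: eqP => [->|_]; last by rewrite mulr0 !mul0r.
by rewrite mulr1 mul1r -natrM mulnb andbC.
Qed.

(* The polynomial of mx_eval_det_affine used here completes the minor of g on
   the support of v in the south-west block to an n x n determinant, so that
   it vanishes on the cell of w as soon as the block of w has smaller rank. *)
Lemma schubert_rank v w (c : C) m q :
  schubert sl w (c *: pmat v) -> (#|sw_block v m q| <= #|sw_block w m q|)%N.
Proof.
case=> Gc sub; rewrite leqNgt; apply/negP => lt_wv.
pose U := ind_mx [pred i : 'I_n | (m < i)%N].
pose L := ind_mx [pred i : 'I_n | (i <= q)%N].
pose K := sw_block v m q; pose D := pmat v *m ind_mx (predC K).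
have [p pE] := mx_eval_det_affine U L D.
have : mx_eval p (c *: pmat v) = 0.
  apply: sub => _ [b1 [b2 [c' [[_ ub1] [_ ub2] _ ->]]]].
  rewrite pE; apply/eqP/negPn/negP => nz.
  have : \rank (U *m (b1 *m (c' *: pmat w) *m b2) *m L + D)%R = n.
    by apply: mxrank_unit; rewrite unitmxE unitfE.
  (* By triangularity the rows of [b1] beyond m involve only columns beyond m, and the columns of
     [b2] up to q only rows up to q. The block of a cell element is thus a product with the block of
     [w] as a factor. *)
  have Ub1 : U *m b1 = U *m b1 *m U.
    apply/matrixP => i j; rewrite mx_indM !ind_mxM /=.
    case: (ltnP m i) => [mi|_]; last by rewrite !mul0r.
    case: (ltnP m j) => [_|jm]; first by rewrite mulr1.
    by rewrite ub1 ?mulr0 //; exact: leq_ltn_trans mi.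
  have Lb2 : b2 *m L = L *m (b2 *m L).
    apply/matrixP => i j; rewrite ind_mxM !mx_indM /=.
    case: (leqP j q) => [jq|_]; last by rewrite !mulr0.
    case: (leqP i q) => [_|qi]; first by rewrite mul1r.
    by rewrite ub2 ?mul0r ?mulr0 //; exact: leq_ltn_trans qi.
  have -> : U *m (b1 *m (c' *: pmat w) *m b2) *m L =
      U *m b1 *m (c' *: pmat w *m ind_mx (sw_block w m q)) *m (b2 *m L).
    have -> : c' *: pmat w *m ind_mx (sw_block w m q) = U *m (c' *: pmat w) *m L.
      by rewrite -scalemxAl -pmat_sw_block -scalemxAr -scalemxAl.
    move: (c' *: pmat w) => Z.
    have -> : U *m (b1 *m Z *m b2) *m L = (U *m b1) *m Z *m (b2 *m L).
      by rewrite !mulmxA.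
    by rewrite {1}Ub1 {1}Lb2 !mulmxA.
  apply/eqP; rewrite neq_ltn; apply/orP; left.
  apply: leq_ltn_trans (mxrank_add _ _) _.
  have le1 : (\rank (U *m b1 *m (c' *: pmat w *m ind_mx (sw_block w m q))
      *m (b2 *m L)) <= #|sw_block w m q|)%N.
    apply: leq_trans (mxrankM_maxl _ _) _.
    apply: leq_trans (mxrankM_maxr _ _) _.
    apply: leq_trans (mxrankM_maxr _ _) _.
    exact: rank_ind_mx.
  have le2 : (\rank D <= #|predC K|)%N.
    apply: leq_trans (mxrankM_maxr _ _) _; exact: rank_ind_mx.
  apply: leq_ltn_trans (leq_add le1 le2) _.
  apply: (@leq_trans (#|K| + #|predC K|)); first by rewrite ltn_add2r.
  by rewrite cardC card_ord.
rewrite pE -scalemxAr -scalemxAl pmat_sw_block -/K.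
have := inG_unit Gc; rewrite unitmxE unitfE detZ mulf_eq0 negb_or => /andP[cn vn].
rewrite scalemxAr -mulmxDr det_mulmx => /eqP; rewrite mulf_eq0 (negPf vn) /=.
(* At [c *: pmat v] the completed matrix is [pmat v] times a diagonal matrix with entries c and 1,
   hence invertible. *)
have -> : c *: ind_mx K + ind_mx (predC K) =
    diag_mx (\row_i (if K i then c else 1)).
  apply/matrixP => i j; rewrite !mxE /=; case: (K i) => /=.
    by rewrite mul0rn addr0 mulrnAr mulr1.
  by rewrite mul0rn mulr0 add0r.
rewrite det_diag prodf_seq_eq0 => /hasP [i _ /=]; rewrite mxE.
case: (K i); last by rewrite oner_eq0.
move=> /eqP c0; move: cn; rewrite c0 expf_eq0 eqxx andbT -leqNgt.
by move/(leq_trans (ltn_ord i)); rewrite ltn0.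
Qed.

End Group.

(** * Hessenberg spaces: weight decomposition and raising of entries *)

Section Hessenberg.
Variables (sl : bool) (n : nat) (H : {vspace 'M[C]_n}).
Hypothesis hH : hessenberg_space sl H.
Implicit Types Y : 'M[C]_n.

Lemma lie_bracket_diagE (k i j : 'I_n) Y :
  lie_bracket (delta_mx k k) Y i j = ((i == k)%:R - (j == k)%:R) * Y i j.
Proof.
have E : delta_mx k k = ind_mx (pred1 k) :> 'M[C]_n.
  apply/matrixP => a b; rewrite !mxE /=; case: eqP => [->|//] /=.
    by rewrite eq_sym; case: (k == b).
  by rewrite mul0rn.
by rewrite /lie_bracket E mxE ind_mxM mxE mx_indM /= mulrBl (mulrC (Y i j)).
Qed.

(* E_kk is not traceless, but n E_kk - 1 is and has n times its bracket. *)
Lemma hess_ad_diag (k : 'I_n) Y : Y \in H -> lie_bracket (delta_mx k k) Y \in H.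
Proof.
move=> YH; have n0 : n%:R != 0 :> C.
  by case: (n) k => [[]//|m _]; exact: natC_neq0.
have bX : in_borel_lie sl (n%:R *: delta_mx k k - 1%:M : 'M[C]_n).
  split.
    rewrite /in_lie; case: (sl) => //.
    rewrite linearB linearZ /= mxtrace1 /mxtrace (bigD1 k) //= big1 => [|i ik].
      by rewrite mxE eqxx addr0 mulr1 subrr.
    by rewrite mxE (negPf ik).
  move=> i j ji; rewrite !mxE.
  have /negPf ij : i != j by rewrite -val_eqE gtn_eqF.
  rewrite ij subr0; case: andP => [[/eqP ik /eqP jk]|_]; last by rewrite mulr0.
  by rewrite ik jk eqxx in ij.
have := hH.2 _ _ bX YH.
have -> : lie_bracket (n%:R *: delta_mx k k - 1%:M) Y =
          n%:R *: lie_bracket (delta_mx k k) Y.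
  rewrite /lie_bracket mulmxBl mulmxBr mul1mx mulmx1 opprB addrA subrK.
  by rewrite -scalemxAl -scalemxAr -scalerBr.
by move=> /(memvZ n%:R^-1); rewrite scalerA mulVf // scale1r.
Qed.

Lemma hess_entry (k l : 'I_n) Y :
  k != l -> Y \in H -> Y k l *: delta_mx k l \in H.
Proof.
move=> kl YH.
(* Only the entries (k,l) and (l,k) survive both brackets, each negated. Bracketing with E_kk then
   acts by 1 on the first and by -1 on the second, so the sum below isolates (k,l). *)
pose W := lie_bracket (delta_mx l l) (lie_bracket (delta_mx k k) Y).
have WH : W \in H by do 2![apply: hess_ad_diag].
have := memvD WH (hess_ad_diag k WH).
have -> : W + lie_bracket (delta_mx k k) W = - 2 *: (Y k l *: delta_mx k l).
  apply/matrixP => i j; rewrite mxE lie_bracket_diagE /W !lie_bracket_diagE !mxE.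
  have /negPf lk : l != k by rewrite eq_sym.
  move/negPf: kl => kl.
  case: (eqVneq i k) => [->|ik]; case: (eqVneq j l) => [->|jl];
    rewrite ?eqxx ?lk ?kl /=; try ring.
  by case: (i == l); case: (j == k) => /=; ring.
move=> /(memvZ (- 2)^-1); rewrite scalerA mulVf ?scale1r //.
by rewrite oppr_eq0; exact: natC_neq0.
Qed.

Lemma hess_sum_entries Y :
  \sum_i \sum_(j | j != i) Y i j *: delta_mx i j =
  Y - \matrix_(i, j) (Y i i *+ (i == j)).
Proof.
apply/eqP; rewrite eq_sym subr_eq; apply/eqP.
rewrite [LHS]matrix_sum_delta.
have -> : \matrix_(i, j) (Y i i *+ (i == j)) = \sum_i Y i i *: delta_mx i i.
  rewrite [LHS]matrix_sum_delta; apply: eq_bigr => i _.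
  rewrite (bigD1 i) //= big1 ?addr0 ?mxE ?eqxx ?mulr1n // => j ji.
  by rewrite mxE eq_sym (negPf ji) scale0r.
rewrite -big_split; apply: eq_bigr => i _.
by rewrite (bigD1 i) //= addrC.
Qed.

Lemma hess_diag_part Y :
  Y \in H -> \matrix_(i, j) (Y i i *+ (i == j)) \in H.
Proof.
move=> YH; rewrite -(subKr Y (\matrix_(i, j) _)) -hess_sum_entries.
apply: memvB => //.
apply: memv_suml => i _; apply: memv_suml => j ji.
by apply: hess_entry; rewrite // eq_sym.
Qed.

Lemma hess_assemble Y :
  \matrix_(i, j) (Y i i *+ (i == j)) \in H ->
  (forall i j, i != j -> Y i j *: delta_mx i j \in H) -> Y \in H.
Proof.
move=> dH eH.
have -> : Y = \matrix_(i, j) (Y i i *+ (i == j)) +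
              \sum_i \sum_(j | j != i) Y i j *: delta_mx i j.
  by rewrite hess_sum_entries addrC subrK.
apply: memvD => //; apply: memv_suml => i _; apply: memv_suml => j ji.
by apply: eH; rewrite eq_sym.
Qed.

Lemma hess_ad_upper (i j : 'I_n) Y :
  (i < j)%N -> Y \in H -> lie_bracket (delta_mx i j) Y \in H.
Proof.
move=> ij; apply: hH.2; split.
  rewrite /in_lie; case: (sl) => //; rewrite /mxtrace big1 // => k _.
  rewrite mxE; case: (eqVneq k i) => [->|//] /=.
  by rewrite -val_eqE ltn_eqF.
move=> k l lk; rewrite mxE; case: andP => // - [/eqP ki /eqP lj].
by rewrite ki lj ltnNge (ltnW ij) in lk.
Qed.

(** [E_ij, E_jl] = E_il, the other product being zero because l differs from i. *)
Lemma hess_raise_row (i j l : 'I_n) (c : C) :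
  (i < j)%N -> l != i -> c *: delta_mx j l \in H -> c *: delta_mx i l \in H.
Proof.
move=> ij li /(hess_ad_upper ij); rewrite /lie_bracket -scalemxAr -scalemxAl.
by rewrite mul_delta_mx mul_delta_mx_0 // scaler0 subr0.
Qed.

Lemma hess_raise_col (i j k : 'I_n) (c : C) :
  (i < j)%N -> k != j -> c *: delta_mx k i \in H -> c *: delta_mx k j \in H.
Proof.
move=> ij kj /(hess_ad_upper ij); rewrite /lie_bracket -scalemxAr -scalemxAl.
by rewrite mul_delta_mx mul_delta_mx_0 1?eq_sym // scaler0 sub0r memvN.
Qed.

End Hessenberg.

(** * The pattern argument *)

Lemma tperm_if (T : finType) (i j k : T) :
  tperm i j k = if k == i then j else if k == j then i else k.
Proof.
case: tpermP => [->|->|/eqP/negPf -> /eqP/negPf -> //]; rewrite ?eqxx //.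
by case: eqP.
Qed.

Theorem theorem1p8 (sl : bool) (n : nat) (w : 'S_n) :
  (exists (x : 'M[C]_n) (H : {vspace 'M[C]_n}),
     in_lie sl x /\ hessenberg_space sl H /\
     (forall g, hessenberg_variety sl x H g <-> schubert sl w g)) ->
  avoids_pattern [:: 4; 2; 3; 1]%N w.
Proof.
move=> [x [H [_ [hH XW]]]] [f [f_mono f_pat]].
pose p := f (inord 0 : 'I_4); pose q := f (inord 1 : 'I_4).
pose r := f (inord 2 : 'I_4); pose s := f (inord 3 : 'I_4).
have pq : (p < q)%N by apply: f_mono; rewrite !inordK.
have qr : (q < r)%N by apply: f_mono; rewrite !inordK.
have rs : (r < s)%N by apply: f_mono; rewrite !inordK.
have w_sq : (w s < w q)%N by rewrite f_pat !inordK.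
have w_qr : (w q < w r)%N by rewrite f_pat !inordK.
have w_rp : (w r < w p)%N by rewrite f_pat !inordK.
have pr := ltn_trans pq qr; have qs := ltn_trans qr rs.
have ps := ltn_trans pr rs.
have w_sr := ltn_trans w_sq w_qr; have w_qp := ltn_trans w_qr w_rp.
have w_sp := ltn_trans w_sr w_rp.
clearbody p q r s; clear f f_mono f_pat.
have n_gt0 : (0 < n)%N by exact: leq_ltn_trans (leq0n p) (ltn_ord p).
have neq (i j : 'I_n) : (i < j)%N -> ((i == j) = false) * ((j == i) = false).
  by move=> ij; rewrite -!val_eqE ltn_eqF ?gtn_eqF.
(* Rewrite rules deciding every equality between two of the four positions, used to evaluate the
   transpositions. *)
pose N := (neq _ _ pq, neq _ _ pr, neq _ _ ps, neq _ _ qr, neq _ _ qs, neq _ _ rs).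
(* On the positions p, q, r, s the pattern of w is 4231; those of u0, ..., u4
   and v are 1234, 1432, 3214, 3142, 2413 and 3412. *)
pose u0 := (tperm p s * w)%g.
pose u1 := (tperm p s * (tperm p q * w))%g.
pose u2 := (tperm r s * (tperm p r * w))%g.
pose u3 := (tperm q s * (tperm p r * w))%g.
pose u4 := (tperm r s * (tperm p q * w))%g.
pose v := (tperm p r * (tperm q s * (tperm p s * w)))%g.
have conj_in u : below sl u w -> \matrix_(i, j) x (u i) (u j) \in H.
  move=> uw; have [c Gc] := pmat_scaled sl u n_gt0.
  by have [_] := (XW _).2 (below_schubert uw Gc); rewrite (conj_pmat _ Gc).
have b_pq : below sl (tperm p q * w) w by apply: below_tperm => //; exact: below_refl.
have b_pr : below sl (tperm p r * w) w by apply: below_tperm => //; exact: below_refl.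
(* Each of [u0], ..., [u4] arises from [w] by one or two swaps, each removing an inversion. *)
have h0 : \matrix_(i, j) x (u0 i) (u0 j) \in H.
  by apply/conj_in/below_tperm => //; exact: below_refl.
have h1 : \matrix_(i, j) x (u1 i) (u1 j) \in H.
  by apply/conj_in/below_tperm => //; rewrite !permM !tperm_if !(eqxx, N).
have h2 : \matrix_(i, j) x (u2 i) (u2 j) \in H.
  by apply/conj_in/below_tperm => //; rewrite !permM !tperm_if !(eqxx, N).
have h3 : \matrix_(i, j) x (u3 i) (u3 j) \in H.
  by apply/conj_in/below_tperm => //; rewrite !permM !tperm_if !(eqxx, N).
have h4 : \matrix_(i, j) x (u4 i) (u4 j) \in H.
  by apply/conj_in/below_tperm => //; rewrite !permM !tperm_if !(eqxx, N).
have vals k : [\/ k = p, k = q, k = r | k = s] \/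
    ((k == p) = false) * ((k == q) = false) *
    ((k == r) = false) * ((k == s) = false).
  case: (eqVneq k p) => [->|kp]; first by left; constructor 1.
  case: (eqVneq k q) => [->|kq]; first by left; constructor 2.
  case: (eqVneq k r) => [->|kr]; first by left; constructor 3.
  case: (eqVneq k s) => [->|ks]; first by left; constructor 4.
  by right; rewrite ?(negPf kp).
have ag1 k : k \notin [:: p; r] -> u1 k = v k.
  rewrite !inE !permM !tperm_if.
  by case: (vals k) => [[]->|E]; last rewrite !E; rewrite ?(eqxx, N).
have ag2 k : k \notin [:: q; s] -> u2 k = v k.
  rewrite !inE !permM !tperm_if.
  by case: (vals k) => [[]->|E]; last rewrite !E; rewrite ?(eqxx, N).
have ag3 k : k \notin [:: q; r] -> u3 k = v k.
  rewrite !inE !permM !tperm_if.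
  by case: (vals k) => [[]->|E]; last rewrite !E; rewrite ?(eqxx, N).
have ag4 k : k \notin [:: p; s] -> u4 k = v k.
  rewrite !inE !permM !tperm_if.
  by case: (vals k) => [[]->|E]; last rewrite !E; rewrite ?(eqxx, N).
have entry u (i j : 'I_n) : \matrix_(i, j) x (u i) (u j) \in H -> i != j ->
    x (u i) (u j) *: delta_mx i j \in H.
  by move=> uH ij; have := hess_entry hH ij uH; rewrite mxE.
have vH : \matrix_(i, j) x (v i) (v j) \in H.
  apply: hess_assemble => [|k l kl].
    (* v, u0 differ from each other by (p r)(q s), u1 = v (p r), u2 = v (q s):
       on functions of one position, v = u1 - u0 + u2. *)
    have := memvD (memvB (hess_diag_part hH h1) (hess_diag_part hH h0))
                  (hess_diag_part hH h2).
    congr (_ \in H); apply/matrixP => i j; rewrite !mxE.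
    case: (i == j); last by rewrite !mulr0n subr0 addr0.
    rewrite !mulr1n !permM !tperm_if.
    by case: (vals i) => [[]->|E]; last rewrite !E; rewrite ?(eqxx, N); ring.
  rewrite mxE.
  case: (boolP ((k \notin [:: p; r]) && (l \notin [:: p; r])))
    => [/andP[k1 l1]|m1].
    by rewrite -!ag1 // entry.
  case: (boolP ((k \notin [:: q; s]) && (l \notin [:: q; s])))
    => [/andP[k1 l1]|m2].
    by rewrite -!ag2 // entry.
  case: (boolP ((k \notin [:: q; r]) && (l \notin [:: q; r])))
    => [/andP[k1 l1]|m3].
    by rewrite -!ag3 // entry.
  case: (boolP ((k \notin [:: p; s]) && (l \notin [:: p; s])))
    => [/andP[k1 l1]|m4].
    by rewrite -!ag4 // entry.
  (* The excluded pairs form a 4-cycle p, r, q, s. A pair (k,l) meeting all four edges is {p,q} or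
     {r,s} in some order; these four entries occur in [u1] or [u2] at a lower row or a column
     further left. *)
  move: m1 m2 m3 m4 kl; rewrite !inE.
  case: (vals k) => [[]->|Ek]; case: (vals l) => [[]->|El];
    rewrite ?Ek ?El ?eqxx ?N //= => _ _ _ _ _.
  - have := entry u1 r q h1; rewrite !permM !tperm_if !(eqxx, N).
    by move=> /(_ isT); apply: (hess_raise_row hH pr); rewrite ?N.
  - have := entry u2 s p h2; rewrite !permM !tperm_if !(eqxx, N).
    by move=> /(_ isT); apply: (hess_raise_row hH qs); rewrite ?N.
  - have := entry u2 r q h2; rewrite !permM !tperm_if !(eqxx, N).
    by move=> /(_ isT); apply: (hess_raise_col hH qs); rewrite ?N.
  - have := entry u1 s p h1; rewrite !permM !tperm_if !(eqxx, N).
    by move=> /(_ isT); apply: (hess_raise_col hH pr); rewrite ?N.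
have [c Gc] := pmat_scaled sl v n_gt0.
have : schubert sl w (c *: pmat v) by apply/XW; split; rewrite ?(conj_pmat _ Gc).
(* In columns up to q and rows beyond [w q], pattern 4231 has a 1 in column p but none in column q,
   while 3412 has one in both; other columns up to q agree. *)
move=> /(schubert_rank (w q) q); rewrite leqNgt => /negP; apply.
apply: proper_card; apply/properP; split.
  apply/subsetP => i; rewrite !inE => /andP [iq mi]; rewrite iq /=.
  rewrite !permM !tperm_if.
  case: (vals i) iq mi => [[]->|E]; last by rewrite !E.
  - by rewrite ?(eqxx, N).
  - by rewrite ltnn.
  - by rewrite leqNgt qr.
  - by rewrite leqNgt qs.
exists q; rewrite !inE leqnn ?ltnn //=.
by rewrite !permM !tperm_if !(eqxx, N).
Qed.
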